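(* Let $\Phi$ be a real-valued continuously differentiable function with locally Lipschitz gradient on an open neighborhood of $\mathrm{St}(n,p)$ in $\mathbb R^{n\times p}$, let $\nabla\Phi$ be its Euclidean gradient, let $A(X)=\nabla\Phi(X)X^\top-X\nabla\Phi(X)^\top$, and let $\operatorname{grad}\Phi$ denote the Riemannian gradient of $\Phi|_{\mathrm{St}(n,p)}$ for the canonical metric. For $X^\star\in\mathrm{St}(n,p)$, the following statements are equivalent: (i) $\operatorname{grad}\Phi(X^\star)=0$; (ii) $A(X^\star)X^\star=0$; (iii) there exists a symmetric matrix $\Lambda^\star\in\mathbb R^{p\times p}$ such that $\nabla\Phi(X^\star)=X^\star\Lambda^\star$. Hence Riemannian stationarity is equivalent to the KKT condition associated with the constraint $X^\top X=I_p$.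
   Context: $\mathrm{St}(n,p)=\{X\in\mathbb R^{n\times p}:X^\top X=I_p\}$ is the Stiefel manifold. The canonical metric is $\mathsf g_X(\xi,\zeta)=\operatorname{tr}\bigl(\xi^\top(I-\tfrac12XX^\top)\zeta\bigr)$ for $\xi,\zeta\in T_X\mathrm{St}(n,p)$. The Riemannian gradient $\operatorname{grad}\Phi(X)\in T_X\mathrm{St}(n,p)$ is defined by $\mathsf g_X(\operatorname{grad}\Phi(X),\xi)=D\Phi(X)[\xi]$ for all $\xi\in T_X\mathrm{St}(n,p)$; for this metric $\operatorname{grad}\Phi(X)=\nabla\Phi(X)-X\nabla\Phi(X)^\top X=A(X)X$. The KKT condition associated with $X^\top X=I_p$ is the existence of a symmetric multiplier matrix as in (iii). *)

(* Defs.v *)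
From mathcomp Require Export all_boot all_order all_algebra.
From mathcomp Require Export all_classical all_reals all_analysis.
Export numFieldNormedType.Exports.

Set Implicit Arguments.
Unset Strict Implicit.
Unset Printing Implicit Defensive.

Import Order.TTheory GRing.Theory Num.Theory.
Local Open Scope classical_set_scope.
Local Open Scope ring_scope.

Definition Stiefel (R : realType) (n p : nat) : set 'M[R]_(n, p) :=
  [set X | X^T *m X = 1%:M].
Arguments Stiefel : clear implicits.

(* T_X St(n, p) as the set of velocities at X of curves on St(n, p); by the
   product rule and a Cayley transform, these are exactly the xi such that
   X^T *m xi is skew-symmetric. *)
Definition tangent (R : realType) (n p : nat) (X : 'M[R]_(n, p)) :
    set 'M[R]_(n, p) :=
  [set xi | exists c : R -> 'M[R]_(n, p),
    [/\ forall t, Stiefel R n p (c t), c 0 = X & is_derive (0 : R) 1 c xi]].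

Definition canonical_metric (R : realType) (n p : nat)
    (X xi zeta : 'M[R]_(n, p)) : R :=
  \tr (xi^T *m (1%:M - 2^-1 *: (X *m X^T)) *m zeta).

Definition egrad (R : realType) (n p : nat) (Phi : 'M[R]_(n, p) -> R)
    (X : 'M[R]_(n, p)) : 'M[R]_(n, p) :=
  \matrix_(i, j) 'D_(delta_mx i j) Phi X.

Definition is_rgrad (R : realType) (n p : nat) (Phi : 'M[R]_(n, p) -> R)
    (X G : 'M[R]_(n, p)) : Prop :=
  tangent X G /\
  forall xi, tangent X xi -> canonical_metric X G xi = 'd Phi X xi.

(* The default value 0 is never used when X is on the Stiefel manifold and Phi
   is differentiable at X: is_rgrad then has exactly one solution. *)
Definition rgrad (R : realType) (n p : nat) (Phi : 'M[R]_(n, p) -> R)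
    (X : 'M[R]_(n, p)) : 'M[R]_(n, p) :=
  xget 0 [set G | is_rgrad Phi X G].

Definition skewA (R : realType) (n p : nat) (Phi : 'M[R]_(n, p) -> R)
    (X : 'M[R]_(n, p)) : 'M[R]_n :=
  egrad Phi X *m X^T - X *m (egrad Phi X)^T.

Definition C1_on (R : realType) (n p : nat) (U : set 'M[R]_(n, p))
    (Phi : 'M[R]_(n, p) -> R) : Prop :=
  forall X, U X -> differentiable Phi X /\ {for X, continuous (egrad Phi)}.

(* The library norm on matrices is the max norm; all norms being equivalent,
   local Lipschitz continuity does not depend on this choice. *)
Definition locally_lipschitz_on (R : realType) (n p : nat)
    (U : set 'M[R]_(n, p)) (F : 'M[R]_(n, p) -> 'M[R]_(n, p)) : Prop :=
  forall X, U X -> exists2 V, nbhs X V & [lipschitz F Y | Y in V].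

(* Main.v *)
Require Import Defs.
From mathcomp Require Import perm lra.

(** Write [E] for the Euclidean gradient at [X], where [X^T X = 1].

    The equivalence of (ii) and (iii) is algebra ([skewA_mulmx_eq0P]): since
    [A(X) X = E - X E^T X], condition (ii) says [E = X (E^T X)], and multiplying
    by [X^T] shows that the multiplier [E^T X] is symmetric; conversely
    [E = X L] with [L] symmetric forces [E^T X = L].

    What remains is [grad Phi(X) = A(X) X] ([rgradE]), which makes (i) and (ii)
    the same equation.  As tangent vectors are velocities of curves, the tangent
    space must first be computed ([tangentP]): it is the set of [xi] with
    [X^T xi] skew-symmetric.  Differentiating [c^T c = 1] gives one inclusion.
    For the other, such a [xi] can be written [W X] with [W] skew-symmetric, and
    the Cayley transforms of [t W / 2] are orthogonal matrices that carry [X]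
    along a curve of velocity [W X] at [t = 0].

    Thus [A(X) X] is tangent, and it represents the differential of [Phi]
    ([is_rgrad_skewA]): [(1 - X X^T / 2) A(X) X = E - X S] with [S] symmetric,
    and [X S] pairs to [0] with tangent vectors because the trace of symmetric
    times skew-symmetric vanishes.  It is the only solution because
    the tangent space is closed under subtraction and the metric is definite
    ([canonical_metric_eq0]). *)

Import Order.TTheory GRing.Theory Num.Theory.
Local Open Scope classical_set_scope.
Local Open Scope ring_scope.

(** * Differentiation of matrix-valued functions *)

Section MatrixCalculus.
Set Implicit Arguments.
Unset Strict Implicit.
Context {R : realFieldType} {V : normedModType R}.

Lemma is_derive_mxP m n (F : V -> 'M[R]_(m, n)) x v dF :
  is_derive x v F dF <-> forall i j, is_derive x v (fun t => F t i j) (dF i j).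
Proof.
split=> [[dFx <-] i j|dFx].
  by split; [exact: (derivable_mxP F x v).1 | rewrite derive_mx // mxE].
have dF1 : derivable F x v by apply/derivable_mxP => i j; case: (dFx i j).
split=> //; apply/matrixP => i j; rewrite derive_mx // mxE.
by case: (dFx i j).
Qed.

Lemma is_derive_mulmx m n p (F : V -> 'M[R]_(m, n)) (G : V -> 'M[R]_(n, p))
    x v dF dG :
  is_derive x v F dF -> is_derive x v G dG ->
  is_derive x v (fun t => F t *m G t) (dF *m G x + F x *m dG).
Proof.
move=> /is_derive_mxP dFx /is_derive_mxP dGx; apply/is_derive_mxP => i j.
have -> : (fun t => (F t *m G t) i j) =
    \sum_k ((fun t => F t i k) * (fun t => G t k j)).
  by apply/funext => t; rewrite mxE fct_sumE.
apply: is_derive_eq; rewrite !mxE -big_split /=.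
by apply: eq_bigr => k _; rewrite addrC /GRing.scale /= [dF i k * _]mulrC.
Qed.

Lemma is_derive_trmx m n (F : V -> 'M[R]_(m, n)) x v dF :
  is_derive x v F dF -> is_derive x v (fun t => (F t)^T) dF^T.
Proof.
move=> /is_derive_mxP dFx; apply/is_derive_mxP => i j; rewrite mxE.
by have -> : (fun t => (F t)^T i j) = (fun t => F t j i)
  by apply/funext => t; rewrite mxE.
Qed.

Lemma is_derive_scalel m n (f : V -> R) (A : 'M[R]_(m, n)) x v df :
  is_derive x v f df -> is_derive x v (fun t => f t *: A) (df *: A).
Proof.
move=> dfx; apply/is_derive_mxP => i j.
have -> : (fun t => (f t *: A) i j) = f * cst (A i j).
  by apply/funext => t; rewrite mxE.
by apply: is_derive_eq; rewrite scaler0 add0r mxE /GRing.scale /= mulrC.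
Qed.

(** The Leibniz formula makes the determinant a polynomial in the entries. *)
Lemma derivable_det n (M : V -> 'M[R]_n) x v :
  (forall i j, derivable (fun t => M t i j) x v) ->
  derivable (fun t => \det (M t)) x v.
Proof.
move=> dM.
have -> : (fun t => \det (M t)) =
  \sum_(s : 'S_n) (cst ((-1) ^+ s) * \prod_i (fun t => M t i (s i))).
  apply/funext => t; rewrite fct_sumE; apply: eq_bigr => s _.
  by rewrite /= fct_prodE.
elim/big_ind : _ => [|f g|s _]; [exact: derivable_cst|exact: derivableD|].
apply: derivableM; first exact: derivable_cst.
by elim/big_ind : _ => // f g; exact: derivableM.
Qed.

(** By Cramer's rule the entries of the inverse are cofactors divided by the
    determinant.  Invertibility is asked everywhere, not only at [x], because
    [invmx] is the identity on singular matrices, where that rule fails. *)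
Lemma derivable_invmx n (M : V -> 'M[R]_n) x v :
  (forall t, M t \in unitmx) -> derivable M x v ->
  derivable (fun t => invmx (M t)) x v.
Proof.
move=> uM /derivable_mxP dM; apply/derivable_mxP => i j.
have -> : (fun t => invmx (M t) i j) =
  (fun t => (\det (M t))^-1) * (cst ((-1) ^+ (j + i)) *
    (fun t => \det (row' j (col' i (M t))))).
  by apply/funext => t; rewrite /invmx uM !mxE.
apply: derivableM.
  apply: derivableV; last exact: derivable_det.
  by have := uM x; rewrite unitmxE unitfE.
apply: derivableM; first exact: derivable_cst.
apply: derivable_det => k l.
have -> : (fun t => row' j (col' i (M t)) k l) =
  (fun t => M t (lift j k) (lift i l)) by apply/funext => t; rewrite !mxE.
exact: dM.
Qed.

End MatrixCalculus.

(** * The Frobenius form and skew-symmetric matrices *)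

Section FrobeniusForm.
Set Implicit Arguments.
Unset Strict Implicit.
Context {R : realFieldType}.

Lemma mxtrace_trmx_mulmx m n (A B : 'M[R]_(m, n)) :
  \tr (A^T *m B) = \sum_j \sum_i A i j * B i j.
Proof.
by apply: eq_bigr => j _; rewrite mxE; apply: eq_bigr => i _; rewrite mxE.
Qed.

Lemma mxtrace_trmx_mul_ge0 m n (A : 'M[R]_(m, n)) : 0 <= \tr (A^T *m A).
Proof.
rewrite mxtrace_trmx_mulmx; apply: sumr_ge0 => j _.
by apply: sumr_ge0 => i _; rewrite -expr2 sqr_ge0.
Qed.

Lemma mxtrace_trmx_mul_eq0 m n (A : 'M[R]_(m, n)) :
  \tr (A^T *m A) = 0 -> A = 0.
Proof.
rewrite mxtrace_trmx_mulmx => /eqP.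
rewrite psumr_eq0; last first.
  by move=> j _; apply: sumr_ge0 => i _; rewrite -expr2 sqr_ge0.
move=> /allP A0; apply/matrixP => i j; rewrite mxE.
have := A0 j; rewrite mem_index_enum => /(_ isT) /=.
rewrite psumr_eq0; last by move=> k _; rewrite -expr2 sqr_ge0.
move=> /allP /(_ i); rewrite mem_index_enum => /(_ isT) /=.
by rewrite mulf_eq0 orbb => /eqP.
Qed.

(** Transposition preserves the trace but turns [S K] into [- K S]. *)
Lemma mxtrace_sym_mul_skew n (S K : 'M[R]_n) :
  S^T = S -> K^T = - K -> \tr (S *m K) = 0.
Proof.
move=> Ssym Kskew; have : \tr (S *m K) = - \tr (S *m K).
  by rewrite -{1}mxtrace_tr trmx_mul Ssym Kskew mulNmx raddfN /= mxtrace_mulC.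
lra.
Qed.

(** If [v = v W] then [v v^T = v W v^T], and the quadratic form of a
    skew-symmetric matrix vanishes, so [v = 0]: a real skew-symmetric matrix
    does not have the eigenvalue [1]. *)
Lemma unitmx_sub_skew n (W : 'M[R]_n) : W^T = - W -> 1%:M - W \in unitmx.
Proof.
move=> Wskew; rewrite -row_free_unit; apply: inj_row_free => v.
rewrite mulmxBr mulmx1 => /eqP; rewrite subr_eq0 => /eqP vW.
have v2 : \tr (v^T *m v) = 0.
  rewrite {2}vW mulmxA; apply: mxtrace_sym_mul_skew => //.
  by rewrite trmx_mul trmxK.
exact: mxtrace_trmx_mul_eq0.
Qed.

End FrobeniusForm.

(** * The tangent space of the Stiefel manifold *)

Section Tangent.
Set Implicit Arguments.
Unset Strict Implicit.
Context {R : realType} {n p : nat}.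
Implicit Types X xi G : 'M[R]_(n, p).

(** The Cayley transform of [t W / 2] applied to [X].  When [W] is
    skew-symmetric it is a rational substitute for [exp (t W) X] with the same
    velocity at [t = 0], and it is defined for all [t]. *)
Definition cayley_curve (W : 'M[R]_n) X (t : R) : 'M[R]_(n, p) :=
  invmx (1%:M - (t / 2) *: W) *m (1%:M + (t / 2) *: W) *m X.

(** The Cayley transform of [K] is orthogonal: transposition exchanges [1 - K]
    and [1 + K], and these commute. *)
Lemma Stiefel_cayley_curve (W : 'M[R]_n) X t :
  W^T = - W -> Stiefel R n p X -> Stiefel R n p (cayley_curve W X t).
Proof.
rewrite /Stiefel /cayley_curve /= => Wskew StX; set K := (t / 2) *: W.
have Kskew : K^T = - K by rewrite linearZ /= Wskew scalerN.
have uK : 1%:M - K \in unitmx by exact: unitmx_sub_skew.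
have trK : (1%:M - K)^T = 1%:M + K by rewrite linearB /= trmx1 Kskew opprK.
have trK' : (1%:M + K)^T = 1%:M - K by rewrite linearD /= trmx1 Kskew.
have uK' : 1%:M + K \in unitmx by rewrite -trK unitmx_tr.
have comm : (1%:M - K) *m (1%:M + K) = (1%:M + K) *m (1%:M - K).
  rewrite mulmxBl mulmxDl !mulmxDr !mulmxN !mul1mx !mulmx1 opprD !addrA.
  by rewrite addrK subrK.
have commV : invmx (1%:M - K) *m (1%:M + K) = (1%:M + K) *m invmx (1%:M - K).
  by rewrite -[1%:M + K in LHS](mulmxK uK) -comm -mulmxA mulKmx.
rewrite commV !trmx_mul trmx_inv trK trK' !mulmxA.
by rewrite -(mulmxA _ (1%:M - K)) comm !mulmxA mulmxKV // mulmxK.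
Qed.

(** Only the existence of the derivative uses differentiability of the inverse;
    its value [d] comes from differentiating
    [(1 - (t/2) W) c(t) = (1 + (t/2) W) X] at [0], which gives
    [- W X / 2 + d = W X / 2]. *)
Lemma is_derive_cayley_curve (W : 'M[R]_n) X :
  W^T = - W -> is_derive (0 : R) 1 (cayley_curve W X) (W *m X).
Proof.
move=> Wskew; pose W2 : 'M[R]_n := 2^-1 *: W.
have W2E t : (t / 2) *: W = t *: W2 by rewrite scalerA.
have d1 := is_derive_cst (1%:M : 'M[R]_n) (0 : R) (1 : R).
have dW2 : is_derive (0 : R) 1 (fun t : R => t *: W2) W2.
  by have := is_derive_scalel W2 (is_derive_id (0 : R) 1); rewrite scale1r.
have dp : is_derive (0 : R) 1 (fun t : R => 1%:M + t *: W2) W2.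
  by have := is_deriveD d1 dW2; rewrite add0r.
have dm : is_derive (0 : R) 1 (fun t : R => 1%:M - t *: W2) (- W2).
  by have := is_deriveB d1 dW2; rewrite sub0r.
have um t : 1%:M - t *: W2 \in unitmx.
  apply: unitmx_sub_skew.
  by rewrite /W2 !linearZ /= Wskew !scalerN.
have dX := is_derive_cst X (0 : R) (1 : R).
have -> : cayley_curve W X =
    (fun t : R => invmx (1%:M - t *: W2) *m (1%:M + t *: W2) *m cst X t).
  by apply/funext => t; rewrite /cayley_curve W2E.
set c := (fun t : R => _).
have dc : derivable c 0 1.
  have /derivableP dV : derivable (fun t : R => invmx (1%:M - t *: W2)) 0 1.
    by apply: derivable_invmx => //; case: dm.
  by case: (is_derive_mulmx (is_derive_mulmx dV dp) dX).
have dL := is_derive_mulmx dm (derivableP dc).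
have dR := is_derive_mulmx dp dX.
have LR : (fun t : R => (1%:M - t *: W2) *m c t) =
    (fun t : R => (1%:M + t *: W2) *m cst X t).
  by apply/funext => t; rewrite /c !mulmxA mulmxV // mul1mx.
rewrite LR in dL.
case: dL dR => _ dL [_ dR]; have := etrans (esym dL) dR.
have c0 : c 0 = X.
  by rewrite /c scale0r subr0 addr0 invmx1 !mul1mx.
rewrite c0 scale0r subr0 mul1mx mulmx0 addr0 mulNmx.
move=> /eqP; rewrite addrC subr_eq -mulmxDl => /eqP dcE.
apply: DeriveDef => //; rewrite dcE; congr (_ *m _).
rewrite /W2 -scalerDl (_ : 2^-1 + 2^-1 = 1 :> R) ?scale1r //; lra.
Qed.

(** The definition by curves becomes a linear equation, which makes the tangent
    space visibly closed under subtraction. *)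
Lemma tangentP X xi : Stiefel R n p X ->
  tangent X xi <-> (X^T *m xi)^T = - (X^T *m xi).
Proof.
rewrite /Stiefel /= => StX; split.
  case=> c [Stc c0 dc].
  have d1 := is_derive_mulmx (is_derive_trmx dc) dc.
  have d0 : is_derive (0 : R) 1 (fun t => (c t)^T *m c t) 0.
    have -> : (fun t => (c t)^T *m c t) = cst 1%:M.
      by apply/funext => t; exact: Stc.
    exact: is_derive_cst.
  have : xi^T *m X + X^T *m xi = 0.
    by rewrite -{1 2}c0; case: d1 => _ <-; case: d0.
  by rewrite trmx_mul trmxK => /eqP; rewrite addr_eq0 => /eqP.
move=> skew.
(* W is skew by construction, and [W X = xi - X (X^T xi + xi^T X) / 2]; the
   factor 1/2 in P keeps the component [X X^T xi] from being counted twice. *)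
pose P : 'M[R]_n := 1%:M - 2^-1 *: (X *m X^T).
pose W := P *m xi *m X^T - X *m xi^T *m P.
have Psym : P^T = P by rewrite linearB /= trmx1 linearZ /= trmx_mul trmxK.
have Wskew : W^T = - W.
  by rewrite linearB /= !trmx_mul trmxK Psym opprB !mulmxA trmxK.
have WX : W *m X = xi.
  have PX : P *m X = 2^-1 *: X.
    rewrite mulmxBl mul1mx -scalemxAl -mulmxA StX mulmx1.
    by rewrite -{1}[X]scale1r -scalerBl; congr (_ *: _); lra.
  rewrite mulmxBl -!mulmxA StX mulmx1 PX -!scalemxAr.
  rewrite mulmxBl mul1mx -scalemxAl -mulmxA.
  move: skew; rewrite trmx_mul trmxK => ->.
  by rewrite mulmxN scalerN opprK subrK.
exists (cayley_curve W X); split.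
- by move=> t; apply: Stiefel_cayley_curve.
- by rewrite /cayley_curve mul0r scale0r subr0 addr0 invmx1 !mul1mx.
- by have := is_derive_cayley_curve X Wskew; rewrite WX.
Qed.

End Tangent.

(** * The gradient for the canonical metric *)

Section CanonicalMetric.
Set Implicit Arguments.
Unset Strict Implicit.
Context {R : realType} {n p : nat}.
Implicit Types (X xi G : 'M[R]_(n, p)) (Phi : 'M[R]_(n, p) -> R).

Lemma diff_egrad Phi X xi : differentiable Phi X ->
  'd Phi X xi = \tr ((egrad Phi X)^T *m xi).
Proof.
move=> dPhi; rewrite mxtrace_trmx_mulmx {1}[xi]matrix_sum_delta exchange_big.
rewrite linear_sum; apply: eq_bigr => j _; rewrite linear_sum.
apply: eq_bigr => i _.
by rewrite linearZ /= mxE deriveE // mulrC.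
Qed.

Lemma tangentB X xi zeta : Stiefel R n p X ->
  tangent X xi -> tangent X zeta -> tangent X (xi - zeta).
Proof.
move=> StX /(tangentP _ StX) xiT /(tangentP _ StX) zetaT.
apply/(tangentP _ StX).
by rewrite mulmxBr linearB /= xiT zetaT opprB opprK addrC.
Qed.

Lemma canonical_metricBl X G G' xi :
  canonical_metric X (G - G') xi =
  canonical_metric X G xi - canonical_metric X G' xi.
Proof.
by rewrite /canonical_metric [(G - G')^T]linearB /= 2!mulmxBl [LHS]linearB.
Qed.

(** With [Q = 1 - X X^T], an orthogonal projection, twice the metric is
    [|xi|^2 + |Q xi|^2] in the Frobenius norm.  The metric is therefore definite
    on all matrices, tangent or not. *)
Lemma canonical_metric_eq0 X xi : Stiefel R n p X ->
  canonical_metric X xi xi = 0 -> xi = 0.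
Proof.
rewrite /Stiefel /canonical_metric /= => StX.
pose Q : 'M[R]_n := 1%:M - X *m X^T.
have Qsym : Q^T = Q by rewrite linearB /= trmx1 trmx_mul trmxK.
have Qidem : Q *m Q = Q.
  rewrite {2}/Q mulmxBr mulmx1 mulmxBl mul1mx.
  by rewrite -(mulmxA X) (mulmxA X^T) StX mul1mx subrr subr0.
have -> : 1%:M - 2^-1 *: (X *m X^T) = 2^-1 *: (1%:M + Q).
  rewrite /Q; move: (X *m X^T) => Y; apply/matrixP => i j; rewrite !mxE; lra.
rewrite -scalemxAr -scalemxAl mxtraceZ mulmxDr mulmx1 mulmxDl mxtraceD.
have -> : xi^T *m Q *m xi = (Q *m xi)^T *m (Q *m xi).
  by rewrite trmx_mul Qsym mulmxA -(mulmxA xi^T Q Q) Qidem.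
move=> metric0; apply: mxtrace_trmx_mul_eq0.
have := mxtrace_trmx_mul_ge0 xi; have := mxtrace_trmx_mul_ge0 (Q *m xi).
lra.
Qed.

Lemma skewA_mulmx Phi X : Stiefel R n p X ->
  skewA Phi X *m X = egrad Phi X - X *m ((egrad Phi X)^T *m X).
Proof.
by rewrite /Stiefel /= => StX; rewrite mulmxBl -!mulmxA StX mulmx1.
Qed.

Lemma is_rgrad_skewA Phi X : Stiefel R n p X -> differentiable Phi X ->
  is_rgrad Phi X (skewA Phi X *m X).
Proof.
move=> StX dPhi; have := StX; rewrite /Stiefel /= => XX.
rewrite skewA_mulmx //; set E := egrad Phi X.
set G := E - X *m (E^T *m X).
have XG : X^T *m G = X^T *m E - E^T *m X.
  by rewrite mulmxBr (mulmxA X^T X) XX mul1mx.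
split.
  by apply/tangentP => //; rewrite XG linearB /= !trmx_mul !trmxK opprB.
move=> xi /(tangentP _ StX) xiT; rewrite diff_egrad //.
pose P : 'M[R]_n := 1%:M - 2^-1 *: (X *m X^T).
have Psym : P^T = P by rewrite linearB /= trmx1 linearZ /= trmx_mul trmxK.
(* S is the symmetric part of [X^T E]; the metric pairs G with xi as the
   Frobenius form pairs [P G = E - X S] with xi. *)
pose S := 2^-1 *: (X^T *m E + E^T *m X).
have Ssym : S^T = S.
  by rewrite /S linearZ linearD /= !trmx_mul !trmxK addrC.
have PG : P *m G = E - X *m S.
  rewrite mulmxBl mul1mx -scalemxAl -mulmxA XG /G -addrA -opprD scalemxAr.
  rewrite -mulmxDr; congr (E - X *m _); rewrite /S.
  move: (X^T *m E) (E^T *m X) => a b; apply/matrixP => i j; rewrite !mxE; lra.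
rewrite /canonical_metric -/P -{1}Psym -trmx_mul PG linearB /= mulmxBl.
rewrite linearB /= trmx_mul Ssym -mulmxA.
by rewrite (mxtrace_sym_mul_skew Ssym xiT) subr0.
Qed.

Lemma rgradE Phi X : Stiefel R n p X -> differentiable Phi X ->
  rgrad Phi X = skewA Phi X *m X.
Proof.
move=> StX dPhi; have [tG0 G0P] := is_rgrad_skewA StX dPhi.
have [tG GP] : is_rgrad Phi X (rgrad Phi X).
  exact: (xgetPex 0 (ex_intro _ _ (is_rgrad_skewA StX dPhi))).
have tB := tangentB StX tG tG0.
apply/eqP; rewrite -subr_eq0; apply/eqP; apply: (canonical_metric_eq0 StX).
by rewrite canonical_metricBl GP // G0P // subrr.
Qed.

Lemma skewA_mulmx_eq0P Phi X : Stiefel R n p X ->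
  skewA Phi X *m X = 0 <->
  exists Lambda : 'M[R]_p, Lambda^T = Lambda /\ egrad Phi X = X *m Lambda.
Proof.
move=> StX; rewrite skewA_mulmx //; move: StX; rewrite /Stiefel /=.
set E := egrad Phi X => StX; split=> [/eqP|[L [Lsym EL]]].
  rewrite subr_eq0 => /eqP EX; exists (E^T *m X); split => //.
  by rewrite trmx_mul trmxK {1}EX (mulmxA X^T X) StX mul1mx.
by rewrite EL trmx_mul Lsym -(mulmxA L) StX mulmx1 subrr.
Qed.

End CanonicalMetric.

(** * Stationarity and the KKT condition *)

Theorem proposition5p7 (R : realType) (n p : nat)
    (U : set 'M[R]_(n, p)) (Phi : 'M[R]_(n, p) -> R)
    (oU : open U) (StU : Stiefel R n p `<=` U)
    (C1Phi : C1_on U Phi) (lipPhi : locally_lipschitz_on U (egrad Phi))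
    (X : 'M[R]_(n, p)) (StX : Stiefel R n p X) :
  [/\ rgrad Phi X = 0 <-> skewA Phi X *m X = 0,
      skewA Phi X *m X = 0 <->
        (exists Lambda : 'M[R]_p,
           Lambda^T = Lambda /\ egrad Phi X = X *m Lambda)
    & rgrad Phi X = 0 <->
        (exists Lambda : 'M[R]_p,
           Lambda^T = Lambda /\ egrad Phi X = X *m Lambda)].
Proof.
have dPhi : differentiable Phi X by case: (C1Phi X (StU X StX)).
by rewrite rgradE //; split=> //; exact: skewA_mulmx_eq0P.
Qed.
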